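(* For all integers $k\geq 3$, $r\geq 1$ and every real $\mu\in(0,\frac{k-1}{k})$ there exist a dimension $n$ and a set of points $\mathcal{X}\subseteq[k]^n$ such that (i) for every colouring of $\mathcal{X}$ with $r$ colours there is a monochromatic combinatorial line contained in $\mathcal{X}$, and (ii) every $\mathcal{Y}\subseteq\mathcal{X}$ contains a subset $\mathcal{Z}\subseteq\mathcal{Y}$ of size $|\mathcal{Z}|\geq\mu|\mathcal{Y}|$ such that $\mathcal{Z}$ contains no quasiline.
   Context: $[k]=\{1,\dots,k\}$ and $[k]^n$ is the $n$-dimensional Hales–Jewett cube. A combinatorial line in $[k]^n$ is a set of the form $\{\eta(i)\colon i\in[k]\}$ where, for some partition $[n]=C\cup M$ with $C\cap M=\emptyset$ and $M\neq\emptyset$ and some values $u_c\in[k]$ ($c\in C$), the point $\eta(i)$ has $c$-th coordinate $u_c$ for $c\in C$ and $m$-th coordinate $i$ for $m\in M$. A quasiline in $[k]^n$ is a $k$-element subset $L\subseteq[k]^n$ such that for every coordinate $\nu\in[n]$ the $\nu$-th entries of the points of $L$ are either all identical or mutually distinct. *)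

(* Defs.v *)
From mathcomp Require Import all_boot.
From Stdlib Require Import Reals.
Set Implicit Arguments. Unset Strict Implicit. Unset Printing Implicit Defensive.

(* Points of the Hales--Jewett cube [k]^n; [k] = {1..k} is represented by 'I_k = {0..k-1}. *)
Definition point (k n : nat) := {ffun 'I_n -> 'I_k}.

Definition line_point (k n : nat) (M : {set 'I_n}) (u : point k n) (i : 'I_k) : point k n :=
  [ffun c => if c \in M then i else u c].

Definition comb_line (k n : nat) (L : {set point k n}) : Prop :=
  exists (M : {set 'I_n}) (u : point k n),
    M != set0 /\ L = [set line_point M u i | i : 'I_k].

Definition quasiline (k n : nat) (L : {set point k n}) : Prop :=
  #|L| = k /\
  forall nu : 'I_n,
    (forall x y, x \in L -> y \in L -> x nu = y nu) \/
    (forall x y, x \in L -> y \in L -> x != y -> x nu != y nu).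

(* Main.v *)
Require Import Defs.
From mathcomp Require Import all_boot zify.
From Stdlib Require Import Reals Lra.
From mathcomp Require Import ssrnat finfun.
Set Implicit Arguments. Unset Strict Implicit. Unset Printing Implicit Defensive.

(** The construction starts from a [k]-uniform shift hypergraph.  Its vertices
    are injective [m]-tuples over a large set, its edges consist of the [k]
    consecutive windows of a longer sequence.  Its chromatic number is
    unbounded.  For any set [S] of special elements, the [m]-tuples that contain
    a special element and whose first special element has an index not divisible
    by [k] form an independent set.  If [S] is random and sparse and [m] is
    large, a fixed tuple belongs to it with probability close to [(k - 1) / k].

    A partite construction realises this hypergraph in a Hales-Jewett cube:
    points project to vertices, every quasiline projects to an edge, and every
    colouring is constant on the fibres of some copy of an initial system of
    disjoint lines, one for each edge.  In an amalgamation along a vertex, a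
    quasiline could only fail to project to an edge if it came from [k]
    templates whose sets of moving positions are the complements
    [D \ E_1], ..., [D \ E_k] for some partition [D = E_1 + ... + E_k].  Hence
    Hales-Jewett is needed for a family of lines without such a configuration.
    The usual colour focusing argument provides it when the pairs [s < t] in
    the lines [m..m *..* 1..1] (moving in the blocks [s], ..., [t - 1]) are
    restricted to the edges of a graph of large chromatic number without
    triangles. *)

(** * Monochromatic consecutive windows in shift hypergraphs *)

Definition shift_ramsey (m k : nat) : Prop :=
  forall K : finType, exists N : nat, forall c : seq nat -> K,
    exists z : seq nat,
      [/\ size z = m + k.-1, sorted ltn z, all (fun x => x < N) z &
          exists q : K, forall i, i < k -> c (take m (drop i z)) = q].

Lemma shift_ramsey_base : shift_ramsey 1 2.
Proof.
move=> K; exists #|K|.+1 => c.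
have /injectivePn[x [y nxy exy]] : ~~ injectiveb (fun i : 'I_#|K|.+1 => c [:: i : nat]).
  apply/negP => /injectiveP /leq_card; rewrite card_ord; lia.
wlog ltxy : x y nxy exy / x < y.
  move=> W; case: (ltngtP x y) => [lt|gt|e]; first exact: (W x y).
    by apply: (W y x) => //; rewrite eq_sym.
  by case/eqP: nxy; apply: val_inj.
exists [:: x : nat; y : nat]; split=> //=; first by rewrite ltxy.
  by rewrite !ltn_ord.
by exists (c [:: x : nat]); case=> [|[|i]].
Qed.

(* If no colour had a monochromatic path of [k] windows, then recording, for
   each colour, the lengths of the monochromatic paths that end in a given
   [m]-tuple would distinguish the two windows of any [m.+1]-tuple. *)
Lemma shift_ramsey_step m k : 0 < m -> 0 < k ->
  shift_ramsey m 2 -> shift_ramsey m.+1 k.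
Proof.
move=> m_gt0 k_gt0 IH K.
have [N HN] := IH {ffun K * 'I_k.+1 -> bool}.
exists N => c.
pose B (q : K) (p : nat) (x : seq nat) :=
  [exists y : p.-tuple 'I_N, sorted ltn (map val y ++ x) &&
     [forall i : 'I_p, c (take m.+1 (drop i (map val y ++ x))) == q]].
have [z [sz zs zN [h hz]]] :=
  HN (fun x => [ffun qp : K * 'I_k.+1 => B qp.1 qp.2 x]).
case: z sz zs zN hz => [|a w]; rewrite /= addn1 // => -[sw] zs /andP[aN wN] hz.
pose x0 := take m (a :: w).
have e01 : [ffun qp : K * 'I_k.+1 => B qp.1 qp.2 x0]
         = [ffun qp : K * 'I_k.+1 => B qp.1 qp.2 w].
  rewrite -[w in RHS](@take_oversize _ m) ?sw //.
  by rewrite (hz 0 isT) -(hz 1 isT) /= drop0.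
have BS p : B (c (a :: w)) p x0 -> B (c (a :: w)) p.+1 w.
  case/existsP=> y /andP[ys /forallP yc].
  have sy : size (map val y) = p by rewrite size_map size_tuple.
  apply/existsP; exists [tuple of rcons y (Ordinal aN)].
  have -> : map val [tuple of rcons y (Ordinal aN)] ++ w = map val y ++ (a :: w).
    by rewrite /= map_rcons cat_rcons.
  apply/andP; split.
    move: ys; rewrite /x0 -(prednK m_gt0) /= !sorted_cat_cons.
    by case/andP=> -> _.
  apply/forallP => i; apply/eqP.
  have [ip|pi] := ltnP i p.
    rewrite -(eqP (yc (Ordinal ip))) /=; congr c.
    rewrite -[a :: w](cat_take_drop m) -/x0 catA !take_drop takel_cat //.
    rewrite size_cat sy /x0 size_takel /= ?sw //; lia.
  have -> : i = p :> nat by have := ltn_ord i; lia.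
  by rewrite drop_size_cat // take_oversize //= sw.
(* [BS] lengthens a path by one while passing from [x0] to [w], and [e01] carries the new length
   back to [x0]. Iterating reaches [k], the largest length that is recorded. *)
have Bk p : p <= k -> B (c (a :: w)) p x0.
  elim: p => [|p IHp] pk.
    apply/existsP; exists [tuple]; apply/andP; split; last by apply/forallP => -[].
    by rewrite /=; apply: take_sorted.
  have /ffunP/(_ (c (a :: w), inord p.+1)) := e01.
  rewrite !ffunE /= inordK // => ->.
  by apply: BS; apply: IHp; apply: ltnW.
have /existsP[y /andP[ys /forallP yc]] := Bk k (leqnn k).
exists (map val y ++ x0); split=> //.
- rewrite size_cat size_map size_tuple size_takel /= ?sw //; lia.
- rewrite all_cat; apply/andP; split; last first.
    by apply/allP => x /mem_take; move: x; apply/allP; rewrite /= aN.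
  by rewrite all_map; apply/allP => x _ /=.
by exists (c (a :: w)) => i ik; apply/eqP; exact: (yc (Ordinal ik)).
Qed.

(** Two windows suffice at all shorter tuple lengths; only the last step asks for [k] of them. *)
Lemma shift_ramseyP m k : 0 < m -> 0 < k -> shift_ramsey m.+1 k.
Proof.
move=> m_gt0 k_gt0; apply: shift_ramsey_step => //.
case: m m_gt0 => // m _; elim: m => [|m IHm]; first exact: shift_ramsey_base.
exact: shift_ramsey_step.
Qed.

(* The graph is the shift graph on pairs [(a, b)] with [a < b < N], the pair
   being encoded as [a * N + b]. *)
Lemma ordered_triangle_free_graph (K : finType) :
  exists (q : nat) (G : rel nat),
    (forall c : nat -> K, exists s t, [/\ s < t, t <= q, G s t & c s = c t]) /\
    (forall s t u, G s t -> G t u -> ~~ G s u).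
Proof.
have [N HN] := shift_ramseyP (isT : 0 < 1) (isT : 0 < 2) K.
exists (N * N), (fun s t => (s %% N == t %/ N) && (t %/ N < t %% N)); split.
  move=> c; have [z [sz zs zN [h hz]]] := HN (fun x => c (nth 0 x 0 * N + nth 0 x 1)).
  case: z sz zs zN hz => [|a [|b [|d [|]]]] //= _.
  rewrite !andbT => /andP[ab bd] /and3P[aN bN dN] hz.
  have := etrans (hz 0 isT) (esym (hz 1 isT)); rewrite /= => e.
  exists (a * N + b), (b * N + d); split=> //; [nia|nia|].
  have N0 : 0 < N by lia.
  by rewrite modnMDl divnMDl // modnMDl !modn_small // divn_small // addn0 eqxx.
move=> s t u /andP[/eqP e1 l1] /andP[/eqP e2 l2]; apply/negP => /andP[/eqP e3 l3]; lia.
Qed.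

(** * Hales-Jewett for a sparse family of lines *)

Section SparseHalesJewett.
Variables (k : nat) (F : finType).
Hypothesis k_ge3 : 2 < k.

(* A template prescribes a letter or, where it is [None], a moving position. *)
Definition fill (N : finType) (lam : {ffun N -> option F}) (w : N -> F) : {ffun N -> F} :=
  [ffun n => if lam n is Some f then f else w n].

(* Said for every position [n], this is the configuration
   [D \ E_1], ..., [D \ E_k] of moving sets. *)
Definition splits_at (N : finType) (lam : 'I_k -> {ffun N -> option F}) (n : N) : Prop :=
  (forall i, lam i n != None) \/
  (exists i, lam i n != None /\ forall l, l != i -> lam l n = None).

Definition sparse_hj (A : seq F) : Prop :=
  forall K : finType, exists (N : finType) (LL : pred {ffun N -> option F}),
    [/\ forall lam, LL lam -> exists n, lam n = None,
        forall lam n f, LL lam -> lam n = Some f -> f \in A,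
        forall col : {ffun N -> F} -> K, exists2 lam, LL lam &
          {in A &, forall a a', col (fill lam (fun=> a)) = col (fill lam (fun=> a'))} &
        forall lam : 'I_k -> {ffun N -> option F},
          (forall i, LL (lam i)) -> ~ forall n, splits_at lam n].

(* [q] independent blocks; the template chosen in each block makes the colour
   insensitive to changing the letter of that block within [A']. *)
Definition block_hj (A' A : seq F) (q : nat) : Prop :=
  forall K : finType, exists (N : finType) (b : N -> nat) (LL : pred {ffun N -> option F}),
    [/\ forall n, b n < q,
        forall lam j, LL lam -> j < q -> exists n, b n = j /\ lam n = None,
        forall lam n f, LL lam -> lam n = Some f -> f \in A,
        forall col : {ffun N -> F} -> K, exists2 lam, LL lam &
          forall w w' : nat -> F,
            (forall j, w j = w' j \/ (w j \in A' /\ w' j \in A')) ->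
            col (fill lam (w \o b)) = col (fill lam (w' \o b)) &
        forall (lam : 'I_k -> {ffun N -> option F}) j, j < q ->
          (forall i, LL (lam i)) -> ~ forall n, b n = j -> splits_at lam n].

Definition join (N1 N2 : finType) (B : Type) (f : {ffun N1 -> B}) (g : {ffun N2 -> B}) :
    {ffun N1 + N2 -> B} :=
  [ffun n => match n with inl x => f x | inr y => g y end].

Lemma sparse_hj_small (A : seq F) : size A < 2 -> sparse_hj A.
Proof.
move=> sA K; exists unit, (fun lam => lam tt == None); split.
- by move=> lam /eqP e; exists tt.
- by move=> lam [] f /eqP ->.
- move=> col; exists [ffun=> None]; first by rewrite ffunE.
  by case: A sA => [|a [|//]] _ x y //; rewrite !inE => /eqP -> /eqP ->.
- move=> lam L H; have {}L i : lam i tt = None by exact/eqP/L.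
  case: (H tt) => [/(_ (Ordinal (ltnW (ltnW k_ge3))))|[i []]]; by rewrite L.
Qed.

Lemma block_hj0 A' A : block_hj A' A 0.
Proof.
move=> K; exists 'I_0, (fun=> 0), predT; split=> //; first by case.
  by move=> lam [].
move=> col; exists [ffun=> None] => // w w' _; congr (col _).
by apply/ffunP => -[].
Qed.

(** Product argument: the old blocks are treated first, colouring by functions of the content of the
    new block; then the new block is treated, colouring by functions of the letters put into the old
    ones. This is not circular, since the palette for the new block depends on [q] but not on
    [N1]. *)
Lemma block_hjS A' A q (a0 : F) : {subset A' <= A} -> sparse_hj A' ->
  block_hj A' A q -> block_hj A' A q.+1.
Proof.
move=> sub HA' HB K.
have [N2 [L2 [L2n L2A L2c L2s]]] := HA' {ffun {ffun 'I_q -> F} -> K}.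
have [N1 [b [L1 [bq L1n L1A L1c L1s]]]] := HB {ffun {ffun N2 -> F} -> K}.
pose lft (lam : {ffun N1 + N2 -> option F}) := [ffun n => lam (inl n)].
pose rgt (lam : {ffun N1 + N2 -> option F}) := [ffun n => lam (inr n)].
exists (N1 + N2)%type, (fun n => match n with inl x => b x | inr _ => q end),
  (fun lam => L1 (lft lam) && L2 (rgt lam)); split.
- by case=> n; rewrite ltnS ?leqnn // ltnW.
- move=> lam j /andP[l1 l2]; rewrite ltnS leq_eqVlt => /orP[/eqP ->|jq].
    have [n e] := L2n _ l2; exists (inr n); split=> //.
    by move: e; rewrite ffunE.
  have [n [e1 e2]] := L1n _ _ l1 jq; exists (inl n); split=> //.
  by move: e2; rewrite ffunE.
- move=> lam n f /andP[l1 l2]; case: n => n e.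
    by apply: (L1A (lft lam) n) => //; rewrite ffunE.
  by apply/sub/(L2A (rgt lam) n) => //; rewrite ffunE.
- move=> col.
  have [lam1 l1 h1] := L1c (fun w1 => [ffun w2 => col (join w1 w2)]).
  (* The filler [a0] is never read, because [b n < q] for every [n]. *)
  pose ext (v : {ffun 'I_q -> F}) (j : nat) := if insub j is Some i then v i else a0.
  have [lam2 l2 h2] :=
    L2c (fun w2 => [ffun v => col (join (fill lam1 (ext v \o b)) w2)]).
  exists (join lam1 lam2).
    apply/andP; split; [move: l1|move: l2];
      by congr (is_true (_ _)); apply/ffunP => n; rewrite !ffunE.
  move=> w w' ww'.
  have fillE (v : nat -> F) :
      fill (join lam1 lam2) (v \o (fun n => match n with inl x => b x | inr _ => q end))
      = join (fill lam1 (v \o b)) (fill lam2 (fun=> v q)).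
    by apply/ffunP => -[n|n]; rewrite !ffunE.
  rewrite !fillE.
  have /ffunP/(_ (fill lam2 (fun=> w q))) := h1 _ _ ww'; rewrite !ffunE => ->.
  have -> : fill lam1 (w' \o b) = fill lam1 (ext [ffun i : 'I_q => w' i] \o b).
    apply/ffunP => n; rewrite !ffunE /ext /=; case: (lam1 n) => //.
    by rewrite insubT //= => h; rewrite ffunE.
  case: (ww' q) => [->//|[wA w'A]].
  have := h2 _ _ wA w'A.
  by move=> /ffunP/(_ [ffun i : 'I_q => w' i]); rewrite !ffunE.
- move=> lam j jq l; have l1 i := proj1 (andP (l i)); have l2 i := proj2 (andP (l i)).
  move=> H; move: jq; rewrite ltnS leq_eqVlt => /orP[/eqP ej|jq].
    apply: (L2s (fun i => rgt (lam i))) => // n.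
    case: (H (inr n) (esym ej)) => [h|[i [h1 h2]]]; [left=> i|right; exists i].
      by rewrite ffunE.
    by split=> [|l' /h2]; rewrite ffunE.
  apply: (L1s (fun i => lft (lam i)) j) => // n bn.
  case: (H (inl n) bn) => [h|[i [h1 h2]]]; [left=> i|right; exists i].
    by rewrite ffunE.
  by split=> [|l' /h2]; rewrite ffunE.
Qed.

(* The intervals [[s i, t i)] must be [[x, y)], [[y, z)] and copies of [[x, z)]. *)
Lemma interval_split_triangle (G : rel nat) (q : nat) (s t : 'I_k -> nat) :
  (forall i, s i < t i) -> (forall i, t i <= q) -> (forall i, G (s i) (t i)) ->
  (forall j, j < q ->
     (forall i, ~~ (s i <= j < t i)) \/
     (exists i, ~~ (s i <= j < t i) /\ forall l, l != i -> s l <= j < t l)) ->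
  exists x y z, [/\ G x y, G y z & G x z].
Proof.
move=> st tq Gst H.
have k0 : 0 < k by lia.
pose o := Ordinal k0.
have [i1 _ m1] := arg_minnP s (isT : xpredT o).
have [i2 _ m2] := arg_maxnP t (isT : xpredT o).
have {}m1 i : s i1 <= s i by exact: m1.
have {}m2 i : t i <= t i2 by exact: m2.
have cover j i : s i <= j < t i ->
    exists i0, ~~ (s i0 <= j < t i0) /\ forall l, l != i0 -> s l <= j < t l.
  move=> ij; case: (H j); first by have := tq i; lia.
    by move/(_ i); rewrite ij.
  by [].
(* [a] is the only interval absent at the left end of the union, [c] the only one absent at its
   right end; every other interval is the whole union. *)
have [a [a1 a2]] : exists i0, ~~ (s i0 <= s i1 < t i0) /\ forall l, l != i0 -> s l <= s i1 < t l.
  by apply: (cover _ i1); rewrite leqnn st.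
have [c [c1 c2]] : exists i0, ~~ (s i0 <= (t i2).-1 < t i0) /\
    forall l, l != i0 -> s l <= (t i2).-1 < t l.
  by apply: (cover _ i2); have := st i2; lia.
have sE l : l != a -> s l = s i1 by move=> /a2; have := m1 l; lia.
have tE l : l != c -> t l = t i2 by move=> /c2; have := m2 l; have := st i2; lia.
have [eac|nac] := eqVneq a c.
  subst c.
  have [|b [b1 b2]] := cover (s a) a; first by rewrite leqnn st.
  have ba : b != a by apply/eqP => e; move: b1; rewrite e leqnn st.
  move: b1; rewrite (sE _ ba) (tE _ ba) m1 /=.
  by have := st a; have := m2 a; lia.
have [d da dc] : exists2 d : 'I_k, d != a & d != c.
  have : 0 < #|~: [set a; c]|.
    have := cardsC [set a; c]; rewrite card_ord cards2; case: (_ != _); lia.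
  by case/card_gt0P=> d; rewrite !inE negb_or => /andP[]; exists d.
have sc : s c = s i1 by apply: sE; rewrite eq_sym.
have ta : t a = t i2 by apply: tE.
(* If [c] ended after the start of [a], no interval would be absent at [s a]; if it ended before,
   both [a] and [c] would be absent at [t c]. *)
suff e : t c = s a.
  exists (s i1), (s a), (t i2); split.
  - by rewrite -e -sc.
  - by rewrite -ta.
  - by rewrite -(sE d) // -(tE d).
apply/eqP; rewrite eqn_leq; apply/andP; split; rewrite leqNgt; apply/negP => lt.
  have [|b [b1 b2]] := cover (s a) a; first by rewrite leqnn st.
  have [ba|ba] := eqVneq b a; first by move: b1; rewrite ba leqnn st.
  move: b1; rewrite (sE _ ba) m1 /=.
  have [->|bc] := eqVneq b c; first by rewrite lt.
  by rewrite (tE _ bc); have := st a; have := m2 a; lia.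
have [|b [b1 b2]] := cover (t c) d.
  by rewrite (sE _ da) (tE _ dc); have := st c; have := st a; lia.
have [ba|ba] := eqVneq b a.
  by have := b2 c; rewrite ba eq_sym nac => /(_ isT); lia.
by have := b2 a; rewrite eq_sym ba => /(_ isT); lia.
Qed.

(** Colour focusing: [wd s] has [a] in the blocks before [s] and [a0] afterwards, and the graph
    supplies an edge [s < t] on which the colours of these words agree. On the line between them,
    [a] gives [wd t], and the letters of [A'] can be exchanged for [a0], which gives [wd s]. *)
Lemma sparse_hj_cons (a a0 : F) (A' : seq F) :
  a0 \in A' -> sparse_hj A' -> sparse_hj (a :: A').
Proof.
move=> a0A HA K.
have [q [G [Gc Gt]]] := ordered_triangle_free_graph K.
have sub : {subset A' <= a :: A'} by move=> x; rewrite inE orbC => ->.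
have HB : block_hj A' (a :: A') q.
  by elim: (q) => [|p IHp]; [exact: block_hj0 | exact: block_hjS IHp].
have [N [b [L [bq Ln LA Lc Ls]]]] := HB K.
pose tm (lam : {ffun N -> option F}) (s t : nat) : {ffun N -> option F} :=
  [ffun n => if lam n is Some f then Some f else
     if b n < s then Some a else if b n < t then None else Some a0].
pose LL (mu : {ffun N -> option F}) :=
  [exists lam : {ffun N -> option F}, exists s : 'I_q.+1, exists t : 'I_q.+1,
     [&& L lam, s < t, G s t & mu == tm lam s t]].
have LLP mu : LL mu -> exists lam (s t : nat),
    [/\ L lam, s < t, t <= q, G s t & mu = tm lam s t].
  case/existsP=> lam /existsP[s /existsP[t /and4P[h1 h2 h3 /eqP h4]]].
  by exists lam, s, t; split=> //; rewrite -ltnS.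
exists N, LL; split.
- move=> mu /LLP[lam [s [t [Ll st tq _ ->]]]].
  have [n [bn ln]] := Ln lam s Ll (leq_trans st tq).
  by exists n; rewrite ffunE ln bn ltnn st.
- move=> mu n f /LLP[lam [s [t [Ll st tq _ ->]]]]; rewrite ffunE.
  case e: (lam n) => [g|]; first by move=> -[<-]; apply: LA e.
  case: ifP => _; first by move=> -[<-]; rewrite inE eqxx.
  by case: ifP => // _ [<-]; apply: sub.
- move=> col; have [lam Ll h] := Lc col.
  pose wd s j := if j < s then a else a0.
  have [s [t [st tq Gst cst]]] := Gc (fun s => col (fill lam (wd s \o b))).
  exists (tm lam s t).
    apply/existsP; exists lam; apply/existsP.
    exists (Ordinal (leq_trans st (leqW tq) : s < q.+1)); apply/existsP.
    by exists (Ordinal (tq : t < q.+1)); rewrite /= Ll st Gst eqxx.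
  suff hc x : x \in a :: A' ->
      col (fill (tm lam s t) (fun=> x)) = col (fill lam (wd s \o b)).
    by move=> x y /hc -> /hc ->.
  move=> xA; have -> : fill (tm lam s t) (fun=> x) =
      fill lam ((fun j => if j < s then a else if j < t then x else a0) \o b).
    apply/ffunP => n; rewrite !ffunE /=; case: (lam n) => //.
    by case: ifP => // _; case: ifP.
  move: xA; rewrite inE => /orP[/eqP ->|xA].
    rewrite cst; congr col; apply/ffunP => n; rewrite !ffunE /wd /=.
    by case: (lam n) => //; case: ltnP => // sn; rewrite (leq_trans sn (ltnW st)).
  apply: h => j; rewrite /wd; case: ifP => _; first by left.
  by case: ifP => _; [right|left].
move=> mu LLmu Hsp.
have /fin_all_exists[lam /fin_all_exists[s /fin_all_exists[t Hl]]] := fun i => LLP _ (LLmu i).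
have muE i n : mu i n = tm (lam i) (s i) (t i) n by case: (Hl i) => _ _ _ _ ->.
have [|||j jq|x [y [z [Gxy Gyz Gxz]]]] := @interval_split_triangle G q s t.
- by move=> i; case: (Hl i).
- by move=> i; case: (Hl i).
- by move=> i; case: (Hl i).
- have Ll i : L (lam i) by case: (Hl i).
  have [/existsP[i ij]|/existsPn no] := boolP [exists i, s i <= j < t i]; last by left.
  right.
  have [n [bn ln]] := Ln _ _ (Ll i) jq.
  have mun : mu i n = None by rewrite muE ffunE ln bn; case/andP: ij => h1 ->; rewrite ltnNge h1.
  have mv l : mu l n = None -> s l <= j < t l.
    rewrite muE ffunE bn; case: (lam l n) => //; case: ltnP => // _; by case: ltnP.
  case: (Hsp n) => [/(_ i)|[i0 [_ oth]]]; first by rewrite mun.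
  exists i0; split; last by move=> l /oth /mv.
  (* If every interval contained [j], then [mu] and [lam] would agree on block [j], against the
     sparsity within blocks. *)
  apply/negP => i0j.
  have all_j l : s l <= j < t l by have [->//|/oth/mv] := eqVneq l i0.
  apply: (Ls lam j jq Ll) => n' bn'.
  have e l : mu l n' = lam l n'.
    rewrite muE ffunE bn'; case: (lam l n') => //.
    by case/andP: (all_j l) => h1 ->; rewrite ltnNge h1.
  by case: (Hsp n') => [h|[i' [h1 h2]]]; [left=> l|right; exists i'; split=> [|l /h2]];
    rewrite -e.
by have /negP := Gt _ _ _ Gxy Gyz; apply.
Qed.

Lemma sparse_hales_jewett (A : seq F) : sparse_hj A.
Proof.
elim: A => [|a [|a0 A'] IHA]; try exact: sparse_hj_small.
by apply: (@sparse_hj_cons a a0); rewrite ?mem_head.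
Qed.

End SparseHalesJewett.

(** * Partite construction by amalgamation along vertices *)

Section PartiteConstruction.
Variables (k : nat) (V : eqType) (E : ('I_k -> V) -> Prop) (K : finType).
Hypothesis k_ge3 : 2 < k.
Hypothesis E_inj : forall e, E e -> injective e.
Hypothesis E_ext : forall e e', e =1 e' -> E e -> E e'.

Implicit Types T : finType.

Notation pt T := {ffun T -> 'I_k}.

(* [line_point] and [quasiline] for an arbitrary finite coordinate set; a
   quasiline is enumerated by ['I_k]. *)
Definition lpt T (M : {set T}) (u : pt T) (i : 'I_k) : pt T :=
  [ffun c => if c \in M then i else u c].

Definition quasi_family T (y : 'I_k -> pt T) : Prop :=
  forall t, (forall i l, y i t = y l t) \/ injective (fun i => y i t).

(** The injective coordinate rules out constant families, so that [y] really enumerates [k] distinct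
    points. *)
Definition picture T (Pi : {set pt T}) (pi : pt T -> V) : Prop :=
  forall y, quasi_family y -> (exists t, injective (fun i => y i t)) ->
    (forall i, y i \in Pi) -> E (pi \o y).

Definition arrows (W : seq V) T0 (Pi0 : {set pt T0}) (pi0 : pt T0 -> V)
    T (Pi : {set pt T}) (pi : pt T -> V) : Prop :=
  forall col : pt T -> K, exists phi : pt T0 -> pt T,
    [/\ forall x, x \in Pi0 -> phi x \in Pi,
        forall x, x \in Pi0 -> pi (phi x) = pi0 x,
        forall M u, M != set0 -> exists M' u', M' != set0 /\
          forall i, phi (lpt M u i) = lpt M' u' i &
        forall x x', x \in Pi0 -> x' \in Pi0 -> pi0 x = pi0 x' -> pi0 x \in W ->
          col (phi x) = col (phi x')].

Section Amalgamation.
Variables (T : finType) (Pi : {set pt T}) (pi : pt T -> V) (v : V).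
Variables (N : finType) (LL : pred {ffun N -> option (pt T)}).

Definition block (y : pt (N * T)%type) (n : N) : pt T := [ffun t => y (n, t)].

Definition flat (w : {ffun N -> pt T}) : pt (N * T)%type := [ffun nt => w nt.1 nt.2].

Definition copy (lam : {ffun N -> option (pt T)}) (x : pt T) : pt (N * T)%type :=
  flat (fill lam (fun=> x)).

(** Template letters come from the fibre over [v], but [x] runs through all of [Pi], so each
    template carries a full copy of the picture. *)
Definition amalgam : {set pt (N * T)%type} :=
  [set y | [exists lam, exists x, [&& LL lam, x \in Pi & y == copy lam x]]].

(* All blocks of [copy lam x] lie over [v] except possibly the moving ones,
   which carry [x]. *)
Definition amalgam_proj (y : pt (N * T)%type) : V :=
  if [pick n | pi (block y n) != v] is Some n then pi (block y n) else v.

Lemma block_copy lam x n : block (copy lam x) n = if lam n is Some f then f else x.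
Proof. by apply/ffunP => t; rewrite !ffunE /=; case: (lam n). Qed.

Hypothesis LL_moving : forall lam, LL lam -> exists n, lam n = None.
Hypothesis LL_letter : forall lam n f, LL lam -> lam n = Some f ->
  f \in enum [set x in Pi | pi x == v].
Hypothesis LL_sparse : forall lam : 'I_k -> {ffun N -> option (pt T)},
  (forall i, LL (lam i)) -> ~ forall n, splits_at lam n.

Lemma LL_fiber lam n f : LL lam -> lam n = Some f -> f \in Pi /\ pi f = v.
Proof. by move=> L /(LL_letter L); rewrite mem_enum inE => /andP[-> /eqP]. Qed.

Lemma amalgam_proj_copy lam x : LL lam -> amalgam_proj (copy lam x) = pi x.
Proof.
move=> L; rewrite /amalgam_proj; case: pickP => [n|no].
  rewrite block_copy; case e: (lam n) => [f|//].
  by rewrite (LL_fiber L e).2 eqxx.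
have [n e] := LL_moving L.
by have := no n; rewrite block_copy e => /negbFE/eqP.
Qed.

Lemma amalgamP y : y \in amalgam -> exists lam x, [/\ LL lam, x \in Pi & y = copy lam x].
Proof.
rewrite inE => /existsP[lam /existsP[x /and3P[h1 h2 /eqP h3]]].
by exists lam, x.
Qed.

(** Each block of a quasiline is constant or projects to an edge. If a nonconstant block shows every
    point over its own vertex, that edge is the projection. Otherwise all [x i] lie off [v], exactly
    one template is fixed in each edge block and all are fixed in each constant block, which
    sparsity forbids. *)
Lemma amalgam_picture : picture Pi pi -> picture amalgam amalgam_proj.
Proof.
move=> pic y qy [[n0 t0] inj0] yin.
have /fin_all_exists[lam /fin_all_exists[x Hlx]] := fun i => amalgamP (yin i).
have Ll i : LL (lam i) by case: (Hlx i).
have xPi i : x i \in Pi by case: (Hlx i).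
have yE i : y i = copy (lam i) (x i) by case: (Hlx i).
have bE n i : block (y i) n = if lam i n is Some f then f else x i.
  by rewrite yE block_copy.
have bPi n i : block (y i) n \in Pi.
  by rewrite bE; case e: (lam i n) => [f|//]; have [] := LL_fiber (Ll i) e.
have projE i : amalgam_proj (y i) = pi (x i) by rewrite yE amalgam_proj_copy.
have bdicho n : (forall i l, block (y i) n = block (y l) n) \/
    E (pi \o (fun i => block (y i) n)).
  have [/existsP[t /injectiveP it]|/existsPn no] :=
      boolP [exists t, injectiveb (fun i => y i (n, t))].
    right; apply: pic => //; last by exists t => i l; rewrite !ffunE => /it.
    by move=> t'; case: (qy (n, t')) => h; [left=> i l|right=> i l];
      rewrite !ffunE; [exact: h | move/h].
  left=> i l; apply/ffunP => t; rewrite !ffunE.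
  case: (qy (n, t)) => h; first exact: h.
  by case/negP: (no t); apply/injectiveP.
pose k0 := Ordinal (ltnW (ltnW k_ge3)); pose k1 := Ordinal (ltnW k_ge3).
have En0 : E (pi \o (fun i => block (y i) n0)).
  case: (bdicho n0) => // /(_ k0 k1) /ffunP/(_ t0); rewrite !ffunE.
  by move/inj0.
have [/existsP[n Hn]|/existsPn Hno] := boolP [exists n,
    [exists i, exists l, block (y i) n != block (y l) n] &&
    [forall i, pi (block (y i) n) == pi (x i)]].
  case/andP: Hn => /existsP[i /existsP[l nil]] /forallP Hn.
  case: (bdicho n) => [h|]; first by rewrite (h i l) eqxx in nil.
  by apply: E_ext => j /=; rewrite projE; apply/eqP.
exfalso.
have bad n : E (pi \o (fun i => block (y i) n)) ->
    exists i, lam i n != None /\ pi (block (y i) n) = v /\ pi (x i) != v.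
  move=> En; have := Hno n; rewrite negb_and => /orP[|/forallPn[i]].
    case/existsP; exists k0; apply/existsP; exists k1; apply/negP => /eqP e.
    have : k0 = k1 by apply: (E_inj En) => /=; rewrite e.
    by move/(congr1 val).
  rewrite bE; case e: (lam i n) => [f|]; last by rewrite eqxx.
  move=> h; exists i; rewrite e bE e; split=> //.
  have [_ fv] := LL_fiber (Ll i) e.
  by split=> //; rewrite eq_sym -fv.
have over_v n i : lam i n != None -> pi (block (y i) n) = v.
  rewrite bE; case e: (lam i n) => [f|//] _.
  by have [] := LL_fiber (Ll i) e.
have xv i : pi (x i) != v.
  apply/negP => /eqP xiv.
  have [i' [_ [bi' xi']]] := bad _ En0.
  have bi : pi (block (y i) n0) = v.
    by case e: (lam i n0) => [f|]; [apply: over_v; rewrite e | rewrite bE e].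
  have ii' : i = i' by apply: (E_inj En0) => /=; rewrite bi bi'.
  by rewrite -ii' xiv eqxx in xi'.
apply: (LL_sparse Ll) => n; case: (bdicho n) => [cst|En]; last first.
  right; have [i [li [bi _]]] := bad _ En; exists i; split=> // l nli.
  apply/eqP/negPn/negP => /over_v bl; case/eqP: nli.
  by apply: (E_inj En) => /=; rewrite bi bl.
(* One moving template in a constant block would make all [x l] equal; then [n0], where all
   templates but [i'] move, would show the same point for two indices. *)
left=> i; apply/negP => /eqP li.
have xE l : block (y l) n = x i by rewrite (cst l i) bE li.
have lN l : lam l n = None.
  apply/eqP/negPn/negP => /over_v; rewrite xE => h.
  by have := xv i; rewrite h eqxx.
have xx l : x l = x i by rewrite -(xE l) bE lN.
have [i' [_ [bi' _]]] := bad _ En0.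
have [a [b [ab ai bi]]] : exists a b : 'I_k, [/\ a != b, a != i' & b != i'].
  have : 1 < #|~: [set i']|.
    by have := cardsC [set i']; rewrite card_ord cards1; lia.
  case/card_gt1P=> a [b [ha hb hab]]; exists a, b.
  by split=> //; [move: ha|move: hb]; rewrite !inE.
have bN l : l != i' -> block (y l) n0 = x i.
  move=> nl; rewrite bE; case e: (lam l n0) => [f|//].
  case/eqP: nl; apply: (E_inj En0) => /=; rewrite bi'.
  by apply: over_v; rewrite e.
by case/eqP: ab; apply: (E_inj En0) => /=; rewrite !bN.
Qed.

Lemma copy_lpt lam M u : LL lam -> M != set0 -> exists M' u', M' != set0 /\
  forall i, copy lam (lpt M u i) = lpt M' u' i.
Proof.
move=> L /set0Pn[m mM]; have [n ln] := LL_moving L.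
exists [set nt : N * T | (lam nt.1 == None) && (nt.2 \in M)], (copy lam u); split.
  by apply/set0Pn; exists (n, m); rewrite inE ln mM.
move=> i; apply/ffunP => -[n' t]; rewrite !ffunE inE /=.
by case: (lam n') => [f|] //=; rewrite ffunE.
Qed.

End Amalgamation.

Lemma partite_step T (Pi : {set pt T}) (pi : pt T -> V) (v : V) :
  picture Pi pi ->
  exists T' (Pi' : {set pt T'}) (pi' : pt T' -> V),
    [/\ picture Pi' pi', arrows [:: v] Pi pi Pi' pi' &
        forall y, y \in Pi' -> exists2 x, x \in Pi & pi' y = pi x].
Proof.
move=> pic.
have [N [LL [Ln LA Lc Ls]]] :=
  sparse_hales_jewett k_ge3 (enum [set x in Pi | pi x == v]) K.
exists (N * T)%type, (amalgam Pi LL), (amalgam_proj pi v (N:=N)); split.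
- exact: amalgam_picture.
- move=> col; have [lam L h] := Lc (fun w => col (flat w)).
  exists (copy lam); split.
  + move=> x xPi; rewrite inE; apply/existsP; exists lam; apply/existsP.
    by exists x; rewrite L xPi eqxx.
  + by move=> x _; exact: (amalgam_proj_copy Ln LA).
  + by move=> M u; exact: (copy_lpt Ln).
  + move=> x x' xPi x'Pi e; rewrite inE => /eqP xv.
    by apply: h; rewrite mem_enum inE ?xPi ?x'Pi -?e xv eqxx.
- move=> y /amalgamP[lam [x [L xPi ->]]]; exists x => //.
  exact: (amalgam_proj_copy Ln LA).
Qed.

(** The copy from the later amalgamations is chosen first. It is already monochromatic on fibres
    over [W], and a copy found inside it for [v] inherits this. *)
Lemma partite_construction (W : seq V) : forall T (Pi : {set pt T}) (pi : pt T -> V),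
  picture Pi pi ->
  exists T' (Pi' : {set pt T'}) (pi' : pt T' -> V),
    [/\ picture Pi' pi', arrows W Pi pi Pi' pi' &
        forall y, y \in Pi' -> exists2 x, x \in Pi & pi' y = pi x].
Proof.
elim: W => [|v W IHW] T Pi pi pic.
  exists T, Pi, pi; split=> //; last by move=> y; exists y.
  by move=> col; exists (fun x => x); split=> // M u M0; exists M, u.
have [T1 [Pi1 [pi1 [pic1 arr1 sub1]]]] := partite_step v pic.
have [T2 [Pi2 [pi2 [pic2 arr2 sub2]]]] := IHW _ _ _ pic1.
exists T2, Pi2, pi2; split=> //; last first.
  by move=> y /sub2[x /sub1[x' h1 h2] e]; exists x' => //; rewrite e.
move=> col.
have [phi2 [h21 h22 h23 h24]] := arr2 col.
have [phi1 [h11 h12 h13 h14]] := arr1 (col \o phi2).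
exists (phi2 \o phi1); split.
- by move=> x /h11/h21.
- by move=> x xP /=; rewrite h22 ?h12 ?h11.
- move=> M u /(h13 M u)[M1 [u1 [M1n e1]]].
  have [M2 [u2 [M2n e2]]] := h23 _ u1 M1n.
  by exists M2, u2; split=> // i; rewrite /= e1 e2.
- move=> x x' xP x'P e; rewrite inE => /orP[xv|xW].
    by apply: (h14 x x'); rewrite // inE.
  by apply: h24; rewrite ?h11 // !h12.
Qed.

End PartiteConstruction.

(** * Windows whose first special index avoids the multiples of [k] *)

Definition first_ok (k : nat) (U : Type) (P : pred U) (s : seq U) : bool :=
  (find P s < size s) && (find P s %% k != 0).

Lemma find_drop_sub (U : Type) (P : pred U) (s : seq U) i :
  i <= find P s -> find P (drop i s) = find P s - i.
Proof.
move=> le; have is_ : i <= size s := leq_trans le (find_size P s).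
have := find_cat P (take i s) (drop i s); rewrite cat_take_drop => ->.
by rewrite (has_take_leq P is_) ltnNge le /= size_takel // addKn.
Qed.

Lemma find_take_lt (U : Type) (P : pred U) (s : seq U) m :
  find P s < m -> m <= size s -> find P (take m s) = find P s.
Proof.
move=> lt ms; have := find_cat P (take m s) (drop m s); rewrite cat_take_drop.
by rewrite (has_take_leq P ms) lt.
Qed.

Lemma find_take_eq (U : Type) (P : pred U) (s : seq U) m :
  m <= size s -> find P (take m s) < m -> find P s = find P (take m s).
Proof.
move=> ms lt; have := find_cat P (take m s) (drop m s); rewrite cat_take_drop.
by rewrite has_find size_takel // lt.
Qed.

(* Shifting the window by one decreases the index of the first element of [P]
   by one, so this index becomes divisible by [k] within the first [k] windows. *)
Lemma first_ok_windows k m (U : Type) (P : pred U) (z : seq U) :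
  0 < k -> size z = m + k.-1 ->
  exists2 i, i < k & ~~ first_ok k P (take m (drop i z)).
Proof.
move=> k_gt0 sz.
have mz i : i < k -> m <= size (drop i z) by rewrite size_drop sz; lia.
have sw i : i < k -> size (take m (drop i z)) = m by move=> /mz/size_takel.
have [ok0|] := boolP (first_ok k P (take m z)); last by exists 0; rewrite ?drop0.
case/andP: ok0; have := sw 0 k_gt0; have := mz 0 k_gt0; rewrite drop0 => mz0 -> lt0 _.
have j_lt : find P z < m by rewrite (find_take_eq mz0).
exists (find P z %% k); first by rewrite ltn_mod.
set i := find P z %% k; have ij : i <= find P z by exact: leq_mod.
have ik : i < k by rewrite ltn_mod.
rewrite /first_ok find_take_lt ?mz // find_drop_sub //; last by lia.
have -> : (find P z - i) %% k = 0 by rewrite {1}(divn_eq (find P z) k) addnK modnMl.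
by rewrite andbF.
Qed.

Lemma prod_mem_uniq (U : finType) (s : seq U) (c : nat) : uniq s ->
  \prod_(y : U) (if y \in s then c else 1) = c ^ size s.
Proof. by move=> /card_uniqP <-; rewrite -big_mkcond prod_nat_const. Qed.

(** * Counting the random special sets *)

Section CountSpecial.
Variables (U : finType) (Q : nat).
Implicit Type w : {ffun U -> 'I_Q.+1}.

(** A uniform [w] makes the elements special independently with probability [p = 1 / (Q + 1)]. *)
Definition special w : pred U := fun x => w x == ord0.

(** This is the geometric law [(1 - p) ^ j * p], cleared of denominators: the values of [w] are
    nonzero on the first [j] entries, zero on the next and free elsewhere. *)
Lemma card_find_special (s : seq U) j : uniq s -> j < size s ->
  #|[set w | find (special w) s == j]| * Q.+1 ^ j.+1 = Q ^ j * Q.+1 ^ #|U|.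
Proof.
case: s => [//|a s] us js; set x := nth a (a :: s) j; set s1 := take j (a :: s).
have xs1 : x \notin s1.
  apply/negP => /(nthP a)[i]; rewrite size_takel ?(ltnW js) // => ij.
  rewrite nth_take // => /eqP; rewrite /x nth_uniq //; last exact: ltn_trans js.
  by move/eqP => e; rewrite e ltnn in ij.
have ss1 : size s1 = j by rewrite size_takel // ltnW.
have sE : a :: s = s1 ++ x :: drop j.+1 (a :: s) by rewrite -drop_nth // cat_take_drop.
have us1 : uniq s1 by apply: take_uniq.
pose B y : pred 'I_Q.+1 :=
  if y \in s1 then predC1 ord0 else if y == x then pred1 ord0 else predT.
have -> : #|[set w | find (special w) (a :: s) == j]| = #|family B|.
  apply: eq_card => w; rewrite inE; apply/eqP/familyP.
  - move=> fj y; rewrite /B; case: ifP => [ys1|_].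
      have := before_find (a := special w) (s := a :: s) a (i := index y s1).
      rewrite fj -{1}ss1 index_mem ys1 => /(_ isT).
      by rewrite sE nth_cat index_mem ys1 nth_index // inE /= => /negbT.
    case: ifP => [/eqP ->|//].
    have hs : has (special w) (a :: s) by rewrite has_find fj.
    by have := nth_find a hs; rewrite fj.
  - move=> fam; rewrite sE find_cat.
    have -> : has (special w) s1 = false.
      apply/negbTE/hasPn => y ys1; have := fam y; rewrite /B ys1.
      by rewrite !inE.
    have := fam x; rewrite /B (negbTE xs1) eqxx inE /= => wx.
    by rewrite /special wx ss1 addn0.
rewrite card_family foldrE big_image /=.
have cB y : #|B y| = if y \in s1 then Q else if y == x then 1 else Q.+1.
  rewrite /B; case: ifP => _; first by rewrite cardC1 card_ord.
  by case: ifP => _; rewrite ?card1 // cardT size_enum_ord.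
rewrite (eq_bigr _ (fun y _ => cB y)).
have <- : \prod_(y : U) (if (y \in x :: s1) then Q.+1 else 1) = Q.+1 ^ j.+1.
  by rewrite prod_mem_uniq /= ?ss1 // xs1.
have <- : \prod_(y : U) (if y \in s1 then Q else 1) = Q ^ j.
  by rewrite prod_mem_uniq // ss1.
have <- : \prod_(y : U) Q.+1 = Q.+1 ^ #|U|.
  by rewrite prod_nat_const; congr (_ ^ _); apply: eq_card.
rewrite -!big_split; apply: eq_bigr => y _ /=; rewrite inE.
by case: ifP => _; case: eqP => _ //=; rewrite ?orbT ?mul1n ?muln1.
Qed.

Lemma card_first_ok k (s : seq U) :
  #|[set w | first_ok k (special w) s]| =
  \sum_(0 <= j < size s | j %% k != 0) #|[set w | find (special w) s == j]|.
Proof.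
rewrite big_mkord -sum1dep_card big_mkcond /=.
under [RHS]eq_bigr => j _ do rewrite -sum1dep_card big_mkcond /=.
rewrite exchange_big /=; apply: eq_bigr => w _.
rewrite /first_ok; case: ltnP => [lt|ge] /=; last first.
  by rewrite big1 // => j _; case: eqP => // e; have := ltn_ord j; lia.
case: ifP => [ok|/negbT]; last first.
  rewrite negbK => /eqP nok; rewrite big1 // => j jk; case: eqP => // e.
  by rewrite -e nok in jk.
rewrite (bigD1 (Ordinal lt)) //= eqxx big1 ?addn0 // => j /andP[_ nj].
by case: eqP => // e; case/eqP: nj; apply: val_inj.
Qed.

End CountSpecial.

(** * Density estimates over the reals *)

Section RealEstimates.
Local Open Scope R_scope.

Lemma bernoulli_sub (p : R) (n : nat) : 0 <= p <= 1 -> 1 - INR n * p <= (1 - p) ^ n.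
Proof.
move=> hp; elim: n => [|n IHn]; first by rewrite /=; lra.
rewrite S_INR /=; have := pos_INR n.
have : 0 <= (1 - p) ^ n by apply: pow_le; lra.
have : (1 - p) * (1 - INR n * p) <= (1 - p) * (1 - p) ^ n by apply: Rmult_le_compat_l; lra.
by nra.
Qed.

Lemma INR_sum_ge (c : R) (a : nat -> nat) x d :
  (forall j, (x <= j < x + d)%N -> c <= INR (a j)) ->
  INR d * c <= INR (\sum_(x <= j < x + d) a j).
Proof.
elim: d => [|d IHd] h; first by rewrite addn0 big_geq //=; lra.
rewrite addnS big_nat_recr ?leq_addr // S_INR plus_INR.
have : INR d * c <= INR (\sum_(x <= j < x + d) a j) by apply: IHd => j hj; apply: h; lia.
have : c <= INR (a (x + d)%N) by apply: h; lia.
by rewrite /=; lra.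
Qed.

Lemma INR_expn (a n : nat) : INR (a ^ n)%N = INR a ^ n.
Proof. by elim: n => [|n IHn] //; rewrite expnS mult_INR IHn. Qed.

Lemma geometric_sum_ge (k l : nat) (a : nat -> nat) (w p : R) :
  (0 < k)%N -> 0 <= p <= 1 -> 0 <= w ->
  (forall j, (j < k * l)%N -> INR (a j) = w * p * (1 - p) ^ j) ->
  w * ((INR k - 1) / INR k) * (1 - p) ^ k * (1 - (1 - p) ^ (k * l)) <=
  INR (\sum_(0 <= j < k * l | (j %% k != 0)%N) a j).
Proof.
move=> k_gt0 hp hw.
have k0 : 0 < INR k by apply: lt_0_INR; lia.
have k1 : 1 <= INR k by apply: (le_INR 1); lia.
have q0 n : 0 <= (1 - p) ^ n by apply: pow_le; lra.
elim: l => [|l IHl] h; first by rewrite muln0 big_geq //=; lra.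
have {}IHl := IHl (fun j hj => h j (leq_trans hj (leq_mul (leqnn k) (leqnSn l)))).
have -> : (k * l.+1 = k * l + k)%N by rewrite mulnS addnC.
rewrite (big_cat_nat (n := (k * l)%N)) ?leq_addr // plus_INR pow_add.
set S := \sum_(k * l <= _ < _ | _) _.
have hS : INR k.-1 * (w * p * ((1 - p) ^ (k * l) * (1 - p) ^ k)) <= INR S.
  rewrite /S big_ltn_cond; last by lia.
  rewrite -[(k * l %% k)%N]/(_ %% _)%N mulnC modnMl /= mulnC.
  rewrite (congr_big_nat (k * l).+1 (k * l + k)%N xpredT a) //; last first.
    move=> j hj; have -> : j = (l * k + (j - l * k))%N by lia.
    by rewrite modnMDl modn_small; lia.
  have e : (k * l + k = (k * l).+1 + k.-1)%N by lia.
  rewrite {1}e; apply: INR_sum_ge => j hj; rewrite h; last by lia.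
  apply: Rmult_le_compat_l; first by apply: Rmult_le_pos; lra.
  have -> : (1 - p) ^ (k * l) * (1 - p) ^ k = (1 - p) ^ (k * l + k) by rewrite pow_add.
  have -> : (k * l + k = j + (k * l + k - j))%N by lia.
  rewrite pow_add; have := q0 j.
  have : (1 - p) ^ (k * l + k - j) <= 1 ^ (k * l + k - j) by apply: pow_incr; lra.
  by rewrite pow1; nra.
have hk : INR k.-1 = INR k - 1 by rewrite -{2}(prednK k_gt0) S_INR; lra.
rewrite hk in hS.
have B := bernoulli_sub k hp.
set X := (1 - p) ^ (k * l) in IHl hS *; set Y := (1 - p) ^ k in IHl hS B *.
have X0 : 0 <= X by exact: q0.
have Y0 : 0 <= Y by exact: q0.
apply: Rle_trans (Rplus_le_compat _ _ _ _ IHl hS).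
suff : w * ((INR k - 1) / INR k) * Y * (X - X * Y) <=
       (INR k - 1) * (w * p * (X * Y)) by lra.
have -> : (INR k - 1) * (w * p * (X * Y)) =
   w * ((INR k - 1) / INR k) * Y * X * (INR k * p) by field; lra.
have -> : w * ((INR k - 1) / INR k) * Y * (X - X * Y) =
   w * ((INR k - 1) / INR k) * Y * X * (1 - Y) by ring.
apply: Rmult_le_compat_l; last by lra.
have : 0 <= (INR k - 1) / INR k by apply: Rle_mult_inv_pos; lra.
by move=> nu0; do 3 (apply: Rmult_le_pos => //).
Qed.

Lemma exists_first_ok_density (k : nat) (mu : R) :
  (1 < k)%N -> 0 < mu -> mu < (INR k - 1) / INR k ->
  exists Q m : nat, (1 < m)%N /\
    forall (U : finType) (s : seq U), uniq s -> size s = m ->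
      mu * INR #|{ffun U -> 'I_Q.+1}| <=
      INR #|[set w : {ffun U -> 'I_Q.+1} | first_ok k (special w) s]|.
Proof.
move=> k_gt1 mu_gt0 mu_lt.
have k2 : 2 <= INR k by apply: (le_INR 2); lia.
set nu := (INR k - 1) / INR k in mu_lt.
have nu1 : nu <= 1.
  by apply: (Rmult_le_reg_r (INR k)); rewrite /nu; [lra|field_simplify; lra].
(* Two factors [1 - d] are lost, one from [k * p <= d] and one from cutting the sequence at length
   [m]; [nu * (1 - d) ^ 2 >= nu - 2 * d = mu] since [nu <= 1]. *)
pose d := (nu - mu) / 2.
have d0 : 0 < d by rewrite /d; lra.
have d1 : d < 1 by rewrite /d; lra.
have [Q' hQ] := INR_unbounded (INR k / d).
pose Q := Q'.+1; pose p := / INR Q.+1.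
have Q0 : 0 < INR Q by apply: lt_0_INR; rewrite /Q; lia.
have Q1 : 0 < INR Q.+1 by apply: lt_0_INR; lia.
have pQ : p * INR Q.+1 = 1 by rewrite /p; field; lra.
have p0 : 0 < p by apply: Rinv_0_lt_compat.
have p1 : p < 1.
  apply: (Rmult_lt_reg_r (INR Q.+1)) => //; rewrite pQ S_INR; lra.
have kp : INR k * p <= d.
  apply: (Rmult_le_reg_r (INR Q.+1)) => //; rewrite Rmult_assoc pQ Rmult_1_r.
  have : INR k / d * d < INR Q' * d by apply: Rmult_lt_compat_r.
  have -> : INR k / d * d = INR k by field; lra.
  by rewrite /Q !S_INR; lra.
have [|l hl] := pow_lt_1_zero (1 - p) _ d d0; first by rewrite Rabs_pos_eq; lra.
(* A multiple of [k] gives full periods, and the successor ensures [m > 1] even for [l = 0]. *)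
pose m := (k * l.+1)%N.
exists Q, m; split; first by rewrite /m; nia.
move=> U s us sm; rewrite card_first_ok sm card_ffun card_ord INR_expn.
set w := INR Q.+1 ^ #|U|.
have w0 : 0 <= w by apply: pow_le; lra.
apply: Rle_trans (_ : mu * w <= w * nu * (1 - p) ^ k * (1 - (1 - p) ^ m)) _.
  have a1 : 1 - d <= (1 - p) ^ k by have := @bernoulli_sub p k; lra.
  have a2 : 1 - d <= 1 - (1 - p) ^ m.
    have := hl m ltac:(rewrite /m; nia); rewrite Rabs_pos_eq; first by lra.
    by apply: pow_le; lra.
  have a3 : (1 - d) * (1 - d) <= (1 - p) ^ k * (1 - (1 - p) ^ m).
    by apply: Rmult_le_compat; lra.
  have -> : w * nu * (1 - p) ^ k * (1 - (1 - p) ^ m) =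
            w * (nu * ((1 - p) ^ k * (1 - (1 - p) ^ m))) by ring.
  rewrite Rmult_comm; apply: Rmult_le_compat_l => //.
  apply: Rle_trans (_ : mu <= nu * ((1 - d) * (1 - d))) _; last first.
    by apply: Rmult_le_compat_l; lra.
  have -> : mu = nu - 2 * d by rewrite /d; lra.
  by nra.
apply: geometric_sum_ge => //; [lia|lra|move=> j jm].
have := card_find_special Q us (ltac:(by rewrite sm) : (j < size s)%N).
move=> /(congr1 INR); rewrite !mult_INR !INR_expn -/w => e.
have Qj : INR Q.+1 ^ j.+1 <> 0 by apply: pow_nonzero; lra.
apply: (Rmult_eq_reg_r (INR Q.+1 ^ j.+1)) => //; rewrite e.
have -> : 1 - p = INR Q * p.
  by rewrite -[1 in LHS]pQ S_INR; ring.
rewrite Rpow_mult_distr -[INR Q.+1 ^ j.+1]tech_pow_Rmult.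
have := Rpow_mult_distr p (INR Q.+1) j; rewrite pQ pow1 => e1.
transitivity (INR Q ^ j * w * (p * INR Q.+1) * (p ^ j * INR Q.+1 ^ j)); last by ring.
by rewrite pQ -e1; ring.
Qed.
End RealEstimates.

(** * The initial picture over the shift hypergraph *)

Section ShiftPicture.
Variables (k m : nat) (U : finType).
Hypothesis k_ge3 : 2 < k.
Hypothesis m_gt0 : 0 < m.

Definition window (z : seq U) (i : nat) : seq U := take m (drop i z).

(** The windows may appear in any order, because a quasiline has no preferred enumeration. *)
Definition shift_edge (e : 'I_k -> seq U) : Prop :=
  injective e /\ exists z : seq U,
    size z = m + k.-1 /\ forall j : 'I_k, exists i, e i = window z j.

Lemma shift_edge_ext e e' : e =1 e' -> shift_edge e -> shift_edge e'.
Proof.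
move=> ee' [inj [z [sz ez]]]; split; first exact: eq_inj inj ee'.
by exists z; split=> // j; have [i <-] := ez j; exists i.
Qed.

Lemma nth_window a z i : nth a (window z i) 0 = nth a z i.
Proof. by rewrite nth_take // nth_drop addn0. Qed.

Local Notation Z := ((m + k.-1).-tuple U).
Local Notation T0 := (Z * bool)%type.

Let k0 : 'I_k := Ordinal (ltnW (ltnW k_ge3)).
Let k1 : 'I_k := Ordinal (ltnW k_ge3).

(* The coordinate [(z, false)] keeps the lines of different edges apart: it
   takes only two values, and a quasiline has at least three points. *)
Definition edge_point (z : Z) (i : 'I_k) : {ffun T0 -> 'I_k} :=
  [ffun t => if t.1 == z then (if t.2 then i else k1) else k0].

Definition base_picture : {set {ffun T0 -> 'I_k}} :=
  [set x | [exists z : Z, exists i, uniq z && (x == edge_point z i)]].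

Definition base_proj (x : {ffun T0 -> 'I_k}) : seq U :=
  if [pick zi : Z * 'I_k | x == edge_point zi.1 zi.2] is Some zi
  then window zi.1 zi.2 else [::].

Lemma edge_point_inj z i z' i' : edge_point z i = edge_point z' i' -> z = z' /\ i = i'.
Proof.
move=> e; have zz' : z = z'.
  by move/ffunP/(_ (z, false)): e; rewrite !ffunE /= eqxx; case: eqP.
split=> //; subst z'.
by move/ffunP/(_ (z, true)): e; rewrite !ffunE /= eqxx.
Qed.

Lemma base_proj_edge z i : base_proj (edge_point z i) = window z i.
Proof.
rewrite /base_proj; case: pickP => [[z' i'] /eqP /edge_point_inj[-> ->]//|].
by move=> /(_ (z, i)); rewrite eqxx.
Qed.

Lemma edge_point_base (z : Z) i : uniq z -> edge_point z i \in base_picture.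
Proof.
move=> uz; rewrite inE; apply/existsP; exists z; apply/existsP; exists i.
by rewrite uz eqxx.
Qed.

Lemma base_pictureP x : x \in base_picture ->
  exists (z : Z) (i : 'I_k), uniq z /\ x = edge_point z i.
Proof. by rewrite inE => /existsP[z /existsP[i /andP[uz /eqP ->]]]; exists z, i. Qed.

Lemma edge_point_lpt z i : edge_point z i = lpt [set (z, true)] (edge_point z k0) i.
Proof.
apply/ffunP => -[z' b]; rewrite !ffunE inE xpair_eqE /=.
by case: eqP => // _; case: b.
Qed.

Lemma base_picture_shift : picture shift_edge base_picture base_proj.
Proof.
move=> y qy [t0 inj0] yin.
have /fin_all_exists[z /fin_all_exists[c Hzc]] := fun i => base_pictureP (yin i).
have yE i : y i = edge_point (z i) (c i) by case: (Hzc i).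
have zE i : z i = z k0.
  apply/eqP/negPn/negP => nz.
  case: (qy (z k0, false)) => [/(_ i k0)|inj].
    by rewrite !yE !ffunE /= eqxx eq_sym (negbTE nz).
  (* A third index repeats one of the two values at this coordinate, so it cannot be injective
     there. *)
  have [d di dk0] : exists2 d : 'I_k, d != i & d != k0.
    have : 0 < #|~: [set i; k0]|.
      by have := cardsC [set i; k0]; rewrite card_ord cards2; case: (_ != _); lia.
    by case/card_gt0P=> d; rewrite !inE negb_or => /andP[]; exists d.
  have [e|ne] := eqVneq (z k0) (z d).
    by case/eqP: dk0; apply: inj; rewrite !yE !ffunE /= eqxx e eqxx.
  case/eqP: di; apply: inj; rewrite !yE !ffunE /= (negbTE ne).
  by rewrite eq_sym (negbTE nz).
have uz : uniq (z k0) by case: (Hzc k0).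
have c_inj : injective c.
  by move=> i l e; apply: inj0; rewrite !yE (zE i) (zE l) e.
have pE i : base_proj (y i) = window (z k0) (c i) by rewrite yE base_proj_edge zE.
have sz := size_tuple (z k0).
split.
  move=> i l /=; rewrite !pE => e; apply: c_inj; apply: val_inj => /=.
  have [a _] : exists a : U, true.
    by move: sz; case: (val (z k0)) => [|a w] /= h; [lia | exists a].
  (* Windows are told apart by their first entries, since [z] has no repetition. *)
  have := congr1 (fun s => nth a s 0) e; rewrite !nth_window => /eqP.
  have lt j : c j < size (z k0) by rewrite sz; have := ltn_ord (c j); lia.
  by rewrite nth_uniq // => /eqP.
exists (z k0); split=> // j.
have [g _ gK] := injF_bij c_inj.
by exists (g j); rewrite /= pE gK.
Qed.

End ShiftPicture.

(** * Passage to cubes with numbered coordinates *)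

Section Transfer.
Variables (k : nat) (T : finType).

Definition to_point (x : {ffun T -> 'I_k}) : point k #|T| := [ffun c => x (enum_val c)].

Definition of_point (y : point k #|T|) : {ffun T -> 'I_k} := [ffun t => y (enum_rank t)].

Lemma to_pointK : cancel to_point of_point.
Proof. by move=> x; apply/ffunP => t; rewrite !ffunE enum_rankK. Qed.

Lemma to_point_lpt M u i :
  to_point (lpt M u i) = line_point [set c | enum_val c \in M] (to_point u) i.
Proof. by apply/ffunP => c; rewrite !ffunE inE. Qed.

Lemma quasiline_family (L : {set point k #|T|}) : 1 < k -> quasiline L ->
  exists y : 'I_k -> {ffun T -> 'I_k},
    [/\ quasi_family y, exists t, injective (fun i => y i t) &
        forall i, exists2 x, x \in L & y i = of_point x].
Proof.
move=> k_gt1 [cL qL].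
pose x i := enum_val (cast_ord (esym cL) i).
have xL i : x i \in L by exact: enum_valP.
have x_inj : injective x by move=> i l /enum_val_inj /cast_ord_inj.
have inj t : (forall x y, x \in L -> y \in L -> x != y -> x (enum_rank t) != y (enum_rank t)) ->
    injective (fun i => of_point (x i) t).
  move=> h i l; rewrite !ffunE => e; apply: x_inj; apply/eqP/negPn/negP => nx.
  by have := h _ _ (xL i) (xL l) nx; rewrite e eqxx.
exists (fun i => of_point (x i)); split; last by move=> i; exists (x i).
  move=> t; case: (qL (enum_rank t)) => [h|/inj h]; [left=> i l|by right].
  by rewrite !ffunE; apply: h.
pose k0 := Ordinal (ltnW k_gt1); pose k1 := Ordinal k_gt1.
(* Two distinct points differ in some coordinate, and there the entries of [L] must be mutually
   distinct. *)
have /eqP/ffunP : x k0 != x k1 by apply/eqP => /x_inj /(congr1 val).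
case: (boolP [exists c, x k0 c != x k1 c]) => [/existsP[c nc] _|/existsPn no []].
  exists (enum_val c); apply: inj; rewrite enum_valK.
  case: (qL c) => // h; by rewrite (h (x k0) (x k1)) // eqxx in nc.
by move=> c; apply/eqP/negPn.
Qed.

End Transfer.

(** * Averaging over special sets and assembly of the theorem *)

Lemma INR_sum_mem_ge (I : finType) (Y : {set I}) (g : I -> nat) (c : R) :
  (forall y, y \in Y -> (c <= INR (g y))%R) ->
  (INR #|Y| * c <= INR (\sum_(y in Y) g y))%R.
Proof.
rewrite cardE -big_enum /= => h.
have {}h y : y \in enum Y -> (c <= INR (g y))%R by rewrite mem_enum; apply: h.
elim: (enum Y) h => [|y s IHs] h; first by rewrite big_nil /=; lra.
rewrite big_cons plus_INR [size _]/= S_INR.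
have := h y (mem_head _ _).
have : (INR (size s) * c <= INR (\sum_(y <- s) g y))%R.
  by apply: IHs => x xs; apply: h; rewrite inE xs orbT.
by lra.
Qed.

(** Double counting of the pairs [(w, y)]: the best [w] does at least as well as the average. *)
Lemma weighted_average (I W : finType) (w0 : W) (Y : {set I}) (ok : W -> pred I) (mu : R) :
  (forall y, y \in Y -> (mu * INR #|W| <= INR #|[set w | ok w y]|)%R) ->
  exists w, (mu * INR #|Y| <= INR #|[set y in Y | ok w y]|)%R.
Proof.
move=> h; have [w _ wmax] := arg_maxnP (fun w => #|[set y in Y | ok w y]|) (isT : xpredT w0).
exists w; have := INR_sum_mem_ge h.
have -> : \sum_(y in Y) #|[set w | ok w y]| = \sum_w #|[set y in Y | ok w y]|.
  under eq_bigr => y _ do rewrite -sum1dep_card big_mkcond.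
  rewrite exchange_big /=; apply: eq_bigr => w' _.
  by rewrite -big_mkcondr sum1dep_card.
have : \sum_w' #|[set y in Y | ok w' y]| <= #|W| * #|[set y in Y | ok w y]|.
  by rewrite -sum_nat_const; apply: leq_sum => w' _; apply: wmax.
move=> /leP /le_INR; rewrite mult_INR => h1 h2.
have W0 : (0 < INR #|W|)%R by apply: lt_0_INR; apply/ltP/card_gt0P; exists w0.
by apply: (Rmult_le_reg_l (INR #|W|)) => //; lra.
Qed.

Theorem theorem1p7 (k r : nat) (mu : R) :
  (3 <= k)%N -> (1 <= r)%N ->
  (0 < mu)%R -> (mu < (INR k - 1) / INR k)%R ->
  exists (n : nat) (X : {set point k n}),
    (forall col : point k n -> 'I_r,
        exists L : {set point k n},
          comb_line L /\ L \subset X /\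
          exists c : 'I_r, forall x, x \in L -> col x = c) /\
    (forall Y : {set point k n}, Y \subset X ->
        exists Z : {set point k n},
          Z \subset Y /\ (mu * INR #|Y| <= INR #|Z|)%R /\
          forall L : {set point k n}, L \subset Z -> ~ quasiline L).
Proof.
move=> k_ge3 r_gt0 mu_gt0 mu_lt.
have k_gt0 : 0 < k by lia.
have [Q [m [m_gt1 dens]]] := exists_first_ok_density (ltnW k_ge3) mu_gt0 mu_lt.
have m_gt0 : 0 < m by lia.
have m1 : 0 < m.-1 by lia.
have := shift_ramseyP m1 k_gt0; rewrite prednK // => /(_ 'I_r)[N HN].
(* The successor only makes the type inhabited, as [inord] requires. *)
pose U : finType := 'I_N.+1.
pose Pi0 := base_picture m U k_ge3; pose pi0 := base_proj (m:=m) (U:=U) k_ge3.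
pose Z := (m + k.-1).-tuple U.
(* All vertices that lie under points of [Pi0]. *)
pose W : seq (seq U) :=
  [seq window m (val z) (val i) | z : Z <- enum {: Z}, i : 'I_k <- enum 'I_k].
have [T [Pi [pi [pic arr sub]]]] :=
  partite_construction 'I_r k_ge3 (fun e (h : shift_edge m e) => h.1)
    (@shift_edge_ext k m U) W (@base_picture_shift k m U k_ge3 m_gt0).
exists #|T|, [set y | of_point y \in Pi]; split.
- move=> col.
  have [phi [phiPi phipi phil phic]] := arr (col \o @to_point k T).
  pose o := Ordinal r_gt0.
  (* A tuple inherits the common colour of its fibre in the copy, so any picked point will do; [o]
     is a filler for empty fibres. *)
  pose c (A : seq nat) := if [pick x in Pi0 | pi0 x == map inord A] is Some x
    then col (to_point (phi x)) else o.
  have [z [sz zs zN [q hq]]] := HN c.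
  have sz' : size (map (inord : nat -> U) z) == m + k.-1 by rewrite size_map sz.
  pose zt : (m + k.-1).-tuple U := Tuple sz'.
  have uz : uniq zt.
    rewrite /= map_inj_in_uniq; first exact: (sorted_uniq ltn_trans ltnn zs).
    move=> x x' /(allP zN) xN /(allP zN) x'N /(congr1 val).
    by rewrite /= !inordK // ltnW.
  have colq i : col (to_point (phi (edge_point k_ge3 zt i))) = q.
    rewrite -(hq i (ltn_ord i)) /c map_take map_drop.
    have eP := edge_point_base k_ge3 i uz.
    have pE : pi0 (edge_point k_ge3 zt i) = window m zt i by exact: base_proj_edge.
    case: pickP => [x /andP[xP /eqP xe]|/(_ (edge_point k_ge3 zt i))]; last first.
      by rewrite eP pE eqxx.
    apply: phic => //; first by rewrite -/pi0 pE xe.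
    by rewrite -/pi0 pE; apply: allpairs_f; rewrite mem_enum.
  have M0 : [set (zt, true)] != set0 by apply/set0Pn; exists (zt, true); rewrite inE.
  have [M' [u' [M'0 phiE]]] := phil _ (edge_point k_ge3 zt (Ordinal k_gt0)) M0.
  have lE i : line_point [set c | enum_val c \in M'] (to_point u') i =
      to_point (phi (edge_point k_ge3 zt i)).
    rewrite -to_point_lpt -phiE (edge_point_lpt _ _ i).
    congr (to_point (phi (lpt _ (edge_point _ _ _) _))).
    exact: val_inj.
  exists [set line_point [set c | enum_val c \in M'] (to_point u') i | i : 'I_k]; split.
    exists [set c | enum_val c \in M'], (to_point u'); split=> //.
    by case/set0Pn: M'0 => t tM; apply/set0Pn; exists (enum_rank t); rewrite inE enum_rankK.
  split.
    apply/subsetP => _ /imsetP[i _ ->]; rewrite inE lE to_pointK.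
    exact/phiPi/edge_point_base.
  by exists q => _ /imsetP[i _ ->]; rewrite lE colq.
- move=> Y YX.
  have [|w hw] := weighted_average (Y := Y) (mu := mu) [ffun=> ord0 : 'I_Q.+1]
      (ok := fun (w : {ffun U -> 'I_Q.+1}) y => first_ok k (special w) (pi (of_point y))).
    move=> y /(subsetP YX); rewrite inE => /sub[x xP ->].
    have [z [i [uz ->]]] := base_pictureP xP.
    rewrite base_proj_edge; apply: dens; first by rewrite take_uniq // drop_uniq.
    by rewrite size_takel // size_drop size_tuple; have := ltn_ord i; lia.
  exists [set y in Y | first_ok k (special w) (pi (of_point y))]; split.
    by apply/subsetP => y; rewrite inE => /andP[].
  split=> // L LZ /(quasiline_family (ltnW k_ge3))[y [qy ndy yL]].
  have yok i : y i \in Pi /\ first_ok k (special w) (pi (y i)).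
    have [x /(subsetP LZ)] := yL i; rewrite inE => /andP[xY xok] ->.
    by split=> //; have := subsetP YX _ xY; rewrite inE.
  (* The quasiline projects to an edge, and one of the [k] windows of an edge always fails
     [first_ok]. *)
  have [_ [z [sz ez]]] := pic y qy ndy (fun i => (yok i).1).
  have [j jk] := first_ok_windows (special w) k_gt0 sz.
  have [i ei] := ez (Ordinal jk); rewrite -[take m _]/(window m z (Ordinal jk)) -ei.
  by rewrite (yok i).2.
Qed.
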